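(* Let $\mathcal{A}\in\mathbb{R}^{m\times p\times n}$, let $Q,W,Z$ be its orthogonal HOSVD factor matrices, let $\mathcal{A}_{\mathbf{k}}$ be the truncated HOSVD approximation of $\mathcal{A}$ with $\mathbf{k}=(k_1,k_2,k_3)$, and take $M=Z^\top$. For $\kappa:=\min(k_1,k_2)$, let $\mathcal{A}_\kappa$ be the t-rank $\kappa$ truncated t-SVDM approximation of $\mathcal{A}$ under $\star_M$. Then $$\|\mathcal{A}-\mathcal{A}_\kappa\|_F\le\|\mathcal{A}-\mathcal{A}_{\mathbf{k}}\|_F,$$ with equality only if $\mathcal{A}_{\mathbf{k}}=\mathcal{A}_\kappa$.
   Context: MATLAB index notation is used; $\|\cdot\|_F$ is the Frobenius norm. Mode products: $(\mathcal{A}\times_1F)_{a,j,k}=\sum_iF_{ai}\mathcal{A}_{i,j,k}$, $(\mathcal{A}\times_2F)_{i,b,k}=\sum_jF_{bj}\mathcal{A}_{i,j,k}$, $(\mathcal{A}\times_3F)_{i,j,c}=\sum_kF_{ck}\mathcal{A}_{i,j,k}$. HOSVD: $Q\in\mathbb{R}^{m\times m}$, $W\in\mathbb{R}^{p\times p}$, $Z\in\mathbb{R}^{n\times n}$ are the (full, orthogonal) matrices of left singular vectors of the mode-1, mode-2, mode-3 unfoldings of $\mathcal{A}$ (the matrices whose columns are the mode-1, mode-2, mode-3 fibers), ordered by non-increasing singular values. Truncated HOSVD with $k_1\le m,k_2\le p,k_3\le n$: $\mathcal{C}_{\mathbf{k}}=\mathcal{A}\times_1Q_{:,1:k_1}^\top\times_2W_{:,1:k_2}^\top\times_3Z_{:,1:k_3}^\top$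 and $\mathcal{A}_{\mathbf{k}}=\mathcal{C}_{\mathbf{k}}\times_1Q_{:,1:k_1}\times_2W_{:,1:k_2}\times_3Z_{:,1:k_3}$. For an invertible $n\times n$ matrix $M$, $\widehat{\mathcal{A}}=\mathcal{A}\times_3M$. The product $\mathcal{C}=\mathcal{A}\star_M\mathcal{B}$ is defined by $\widehat{\mathcal{C}}_{:,:,i}=\widehat{\mathcal{A}}_{:,:,i}\widehat{\mathcal{B}}_{:,:,i}$ ($i=1,\dots,n$), $\mathcal{C}=\widehat{\mathcal{C}}\times_3M^{-1}$; the transpose by $(\widehat{\mathcal{A}^{\rm H}})_{:,:,i}=(\widehat{\mathcal{A}}_{:,:,i})^{\rm H}$. The t-SVDM is $\mathcal{A}=\mathcal{U}\star_M\mathcal{S}\star_M\mathcal{V}^{\rm H}$, where for each $i$, $\widehat{\mathcal{A}}_{:,:,i}=\widehat{\mathcal{U}}_{:,:,i}\widehat{\mathcal{S}}_{:,:,i}\widehat{\mathcal{V}}_{:,:,i}^{\rm H}$ is a matrix SVD with singular values in non-increasing order, and $\mathcal{U},\mathcal{S},\mathcal{V}$ are obtained by applying $\times_3M^{-1}$. The t-rank $\kappa$ truncated approximation is $\mathcal{A}_\kappa=\mathcal{U}_{:,1:\kappa,:}\star_M\mathcal{S}_{1:\kappa,1:\kappa,:}\star_M\mathcal{V}_{:,1:\kappa,:}^{\rm H}$.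
   Formalization: The truncated t-SVDM approximation need not be unique, and for a fixed choice the equality claim can fail (n=1, A=I), so equality is shown to imply that A_k is a t-rank κ truncated t-SVDM approximation of A, and A_k=A_κ when that approximation is unique. *)

(* Defs.v *)
From mathcomp Require Import all_boot all_order all_algebra.
Set Implicit Arguments.
Unset Strict Implicit.
Unset Printing Implicit Defensive.
Import Order.TTheory GRing.Theory Num.Theory.
Local Open Scope ring_scope.

(* A third-order tensor is the family of its frontal slices: the entry
   A_{i,j,k} is [A k i j], the frontal slice A_{:,:,k} is [A k]. *)
Notation tensor R m p n := {ffun 'I_n -> 'M[R]_(m, p)}.

Definition fnorm (R : rcfType) (m p n : nat) (A : tensor R m p n) : R :=
  Num.sqrt (\sum_i \sum_j \sum_k A k i j ^+ 2).

Definition mode1 (R : rcfType) (m p n a : nat)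
    (A : tensor R m p n) (F : 'M[R]_(a, m)) : tensor R a p n :=
  [ffun k => \matrix_(r < a, j < p) \sum_(i < m) F r i * A k i j].

Definition mode2 (R : rcfType) (m p n b : nat)
    (A : tensor R m p n) (F : 'M[R]_(b, p)) : tensor R m b n :=
  [ffun k => \matrix_(i < m, r < b) \sum_(j < p) F r j * A k i j].

Definition mode3 (R : rcfType) (m p n c : nat)
    (A : tensor R m p n) (F : 'M[R]_(c, n)) : tensor R m p c :=
  [ffun r => \matrix_(i < m, j < p) \sum_(k < n) F r k * A k i j].

(* The order in which [mxvec] lists the fibers as columns is immaterial: it
   does not change the left singular vectors. *)
Definition unfold1 (R : rcfType) (m p n : nat) (A : tensor R m p n) :
    'M[R]_(m, p * n) :=
  \matrix_(i < m) mxvec (\matrix_(j < p, k < n) A k i j).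

Definition unfold2 (R : rcfType) (m p n : nat) (A : tensor R m p n) :
    'M[R]_(p, m * n) :=
  \matrix_(j < p) mxvec (\matrix_(i < m, k < n) A k i j).

Definition unfold3 (R : rcfType) (m p n : nat) (A : tensor R m p n) :
    'M[R]_(n, m * p) :=
  \matrix_(k < n) mxvec (\matrix_(i < m, j < p) A k i j).

Definition orthogonal_mx (R : rcfType) (n : nat) (U : 'M[R]_n) : Prop :=
  U^T *m U = 1%:M.

(* The primed indices are only used with i = j and i' = j' as naturals, i.e.
   they pick two entries of the diagonal of the rectangular matrix S. *)
Definition is_svd (R : rcfType) (m p : nat) (X : 'M[R]_(m, p))
    (U : 'M[R]_m) (S : 'M[R]_(m, p)) (V : 'M[R]_p) : Prop :=
  [/\ orthogonal_mx U /\ orthogonal_mx V,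
      is_diag_mx S,
      forall i j, 0 <= S i j,
      forall (i i' : 'I_m) (j j' : 'I_p),
        i = j :> nat -> i' = j' :> nat -> (i <= i')%N -> S i' j' <= S i j &
      X = U *m S *m V^T].

Definition left_singular_mx (R : rcfType) (m p : nat) (X : 'M[R]_(m, p))
    (U : 'M[R]_m) : Prop :=
  exists S V, is_svd X U S V.

Definition is_hosvd (R : rcfType) (m p n : nat) (A : tensor R m p n)
    (Q : 'M[R]_m) (W : 'M[R]_p) (Z : 'M[R]_n) : Prop :=
  [/\ left_singular_mx (unfold1 A) Q,
      left_singular_mx (unfold2 A) W &
      left_singular_mx (unfold3 A) Z].

Definition first_cols (R : rcfType) (m p k : nat) (hk : (k <= p)%N)
    (X : 'M[R]_(m, p)) : 'M[R]_(m, k) :=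
  colsub (widen_ord hk) X.

Definition hosvd_core (R : rcfType) (m p n k1 k2 k3 : nat)
    (hk1 : (k1 <= m)%N) (hk2 : (k2 <= p)%N) (hk3 : (k3 <= n)%N)
    (A : tensor R m p n) (Q : 'M[R]_m) (W : 'M[R]_p) (Z : 'M[R]_n) :
    tensor R k1 k2 k3 :=
  mode3 (mode2 (mode1 A (first_cols hk1 Q)^T) (first_cols hk2 W)^T)
        (first_cols hk3 Z)^T.

Definition hosvd_trunc (R : rcfType) (m p n k1 k2 k3 : nat)
    (hk1 : (k1 <= m)%N) (hk2 : (k2 <= p)%N) (hk3 : (k3 <= n)%N)
    (A : tensor R m p n) (Q : 'M[R]_m) (W : 'M[R]_p) (Z : 'M[R]_n) :
    tensor R m p n :=
  mode3 (mode2 (mode1 (hosvd_core hk1 hk2 hk3 A Q W Z) (first_cols hk1 Q))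
               (first_cols hk2 W))
        (first_cols hk3 Z).

(* [invmx M] is the inverse only for invertible M, the intended case. *)
Definition starM (R : rcfType) (m l p n : nat) (M : 'M[R]_n)
    (A : tensor R m l n) (B : tensor R l p n) : tensor R m p n :=
  mode3 [ffun i => mode3 A M i *m mode3 B M i] (invmx M).

Definition trM (R : rcfType) (m p n : nat) (M : 'M[R]_n)
    (A : tensor R m p n) : tensor R p m n :=
  mode3 [ffun i => (mode3 A M i)^T] (invmx M).

(* The slicewise SVDs are stated on the transforms U x_3 M, S x_3 M and
   V x_3 M; for invertible M this amounts to obtaining U, S and V from the
   matrix SVD factors by applying x_3 M^-1. *)
Definition is_tsvdm (R : rcfType) (m p n : nat) (M : 'M[R]_n)
    (A : tensor R m p n)
    (U : tensor R m m n) (S : tensor R m p n) (V : tensor R p p n) : Prop :=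
  (forall i : 'I_n,
     is_svd (mode3 A M i) (mode3 U M i) (mode3 S M i) (mode3 V M i)) /\
  A = starM M (starM M U S) (trM M V).

Definition tsvdm_trunc (R : rcfType) (m p n k : nat)
    (hm : (k <= m)%N) (hp : (k <= p)%N) (M : 'M[R]_n)
    (U : tensor R m m n) (S : tensor R m p n) (V : tensor R p p n) :
    tensor R m p n :=
  starM M
    (starM M [ffun i => first_cols hm (U i)]
             [ffun i => mxsub (widen_ord hm) (widen_ord hp) (S i)])
    (trM M [ffun i => first_cols hp (V i)]).

(* A t-SVDM is not unique when a transformed slice has repeated singular
   values, and then neither is its truncation, so "the t-rank k truncated
   t-SVDM approximation" is a relation between A and B. *)
Definition is_tsvdm_approx (R : rcfType) (m p n k : nat)
    (hm : (k <= m)%N) (hp : (k <= p)%N) (M : 'M[R]_n)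
    (A B : tensor R m p n) : Prop :=
  exists U S V, is_tsvdm M A U S V /\ B = tsvdm_trunc hm hp M U S V.

(* Main.v *)
Require Import Defs.
From mathcomp Require Import all_boot all_order all_algebra.
From mathcomp Require Import ring lra.
Set Implicit Arguments.
Unset Strict Implicit.
Unset Printing Implicit Defensive.
Import Order.TTheory GRing.Theory Num.Theory.
Local Open Scope ring_scope.

(** Multiplying by the orthogonal matrix Z^T along mode 3 preserves the
Frobenius norm, so both errors are sums, over the transformed frontal slices
X, of squared matrix errors.  The slice of the t-SVDM approximation is the
rank-kappa truncation of an SVD of X.  Mode products along different modes
commute, so every transformed slice B of the truncated HOSVD still satisfies
P B = B, where P projects onto the first k1 columns of Q, and B P' = B, where
P' projects onto the first k2 columns of W.  One of the two projections has
trace kappa.  The theorem is thus the Eckart--Young theorem on every slice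
([eckart_young_left], [eckart_young_right]), with its equality case.

For the inequality on a slice X = U S V^T, Pythagoras gives
|X - B|^2 = |X - P X|^2 + |P X - B|^2, and
|X - P X|^2 = |X|^2 - tr(P X X^T), where the trace is the sum of the squared
singular values s_i weighted by the diagonal entries w_i of U^T P U.  These
weights lie in [0, 1] and sum to kappa, so putting all the weight on the first
kappa indices maximizes the sum ([weighted_sum_le_head]).

If equality holds, then B = P X, and there is a threshold t such that
U^T P U agrees with the coordinate projection onto the first kappa axes on
every row whose s_i differs from t.  When t = 0, this already makes P X the
truncation of the given SVD.  Otherwise the two projections differ only inside
the span of the axes with s_i = t, where they have equal trace; an orthogonal
matrix acting on that span alone carries one to the other
([orthoproj_same_trace_frame]).  As S acts on that span as a nonzero multiple
of an isometry, the same rotation can be applied to U and to V without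
spoiling the SVD ([svd_level_rotation]), and P X is the truncation of the
rotated SVD.  The slicewise SVDs assemble into a t-SVDM of the tensor, so the
truncated HOSVD is itself a truncated t-SVDM. *)

(** * Frobenius norm, orthogonal matrices and orthogonal projections *)

Definition sqnorm (R : rcfType) (m p : nat) (X : 'M[R]_(m, p)) : R :=
  \sum_i \sum_j X i j ^+ 2.

Definition is_orthoproj (R : rcfType) (m : nat) (P : 'M[R]_m) : Prop :=
  P^T = P /\ P *m P = P.

Lemma sqnorm_ge0 (R : rcfType) (m p : nat) (X : 'M[R]_(m, p)) : 0 <= sqnorm X.
Proof. by apply: sumr_ge0 => i _; apply: sumr_ge0 => j _; exact: sqr_ge0. Qed.

Lemma sqnorm_eq0 (R : rcfType) (m p : nat) (X : 'M[R]_(m, p)) :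
  sqnorm X = 0 -> X = 0.
Proof.
move=> X0; apply/matrixP=> i j; rewrite mxE.
have rowge0 k : 0 <= \sum_j X k j ^+ 2.
  by apply: sumr_ge0 => l _; exact: sqr_ge0.
have row0 : \sum_j X i j ^+ 2 = 0.
  by apply: (psumr_eq0P _ X0) => // k _; exact: rowge0.
apply/eqP; rewrite -sqrf_eq0; apply/eqP.
by apply: (psumr_eq0P _ row0) => // l _; exact: sqr_ge0.
Qed.

Lemma sqnormE (R : rcfType) (m p : nat) (X : 'M[R]_(m, p)) :
  sqnorm X = \tr (X *m X^T).
Proof.
apply: eq_bigr => i _; rewrite mxE; apply: eq_bigr => j _.
by rewrite mxE expr2.
Qed.

Lemma sqnorm_tr (R : rcfType) (m p : nat) (X : 'M[R]_(m, p)) :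
  sqnorm X^T = sqnorm X.
Proof. by rewrite !sqnormE trmxK mxtrace_mulC. Qed.

Lemma orthogonal_mxV (R : rcfType) (n : nat) (U : 'M[R]_n) :
  orthogonal_mx U -> U *m U^T = 1%:M.
Proof. exact: mulmx1C. Qed.

Lemma orthogonal_mxK (R : rcfType) (n q : nat) (U : 'M[R]_n)
    (X : 'M[R]_(n, q)) :
  orthogonal_mx U -> U^T *m (U *m X) = X.
Proof. by move=> hU; rewrite mulmxA hU mul1mx. Qed.

Lemma orthogonal_mxVK (R : rcfType) (n q : nat) (U : 'M[R]_n)
    (X : 'M[R]_(n, q)) :
  orthogonal_mx U -> U *m (U^T *m X) = X.
Proof. by move=> hU; rewrite mulmxA orthogonal_mxV // mul1mx. Qed.

Lemma orthogonal_mxM (R : rcfType) (n : nat) (U V : 'M[R]_n) :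
  orthogonal_mx U -> orthogonal_mx V -> orthogonal_mx (U *m V).
Proof.
move=> hU hV; rewrite /orthogonal_mx trmx_mul mulmxA -(mulmxA V^T) hU.
by rewrite mulmx1.
Qed.

Lemma orthogonal_mxT (R : rcfType) (n : nat) (U : 'M[R]_n) :
  orthogonal_mx U -> orthogonal_mx U^T.
Proof. by move=> hU; rewrite /orthogonal_mx trmxK orthogonal_mxV. Qed.

(** When the columns of G are orthonormal, the hypothesis says that their span
is stable under P.  Two cases matter: G orthogonal, a change of basis, and G a
basis of a block respected by P. *)
Lemma orthoproj_compress (R : rcfType) (m n : nat) (G : 'M[R]_(m, n))
    (P : 'M[R]_m) :
  G *m G^T *m P *m G = P *m G -> is_orthoproj P ->
  is_orthoproj (G^T *m P *m G).
Proof.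
move=> hG [PT PP]; split; first by rewrite !trmx_mul trmxK PT mulmxA.
rewrite -!mulmxA; congr (_ *m _).
have -> : G *m (G^T *m (P *m G)) = P *m G by rewrite !mulmxA.
by rewrite mulmxA PP.
Qed.

Lemma pid_orthoproj (R : rcfType) (m k : nat) :
  (k <= m)%N -> is_orthoproj (pid_mx k : 'M[R]_m).
Proof. by move=> km; split; [rewrite tr_pid_mx | exact: pid_mx_id]. Qed.

Lemma mxtrace_pid (R : rcfType) (m k : nat) :
  (k <= m)%N -> \tr (pid_mx k : 'M[R]_m) = k%:R.
Proof.
move=> km; rewrite -[in LHS](subnKC km) /pid_mx /mxtrace.
rewrite (eq_bigr (fun i : 'I__ => (i < k)%:R)); last first.
  by move=> i _; rewrite mxE eqxx.
rewrite big_split_ord /= [X in _ + X]big1 ?addr0 => [|i _].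
  rewrite (eq_bigr (fun=> 1)) ?sumr_const ?card_ord // => i _.
  by rewrite ltn_ord.
by rewrite ltnNge leq_addr.
Qed.

(** Pythagoras: X - P X is orthogonal to the range of P, which contains the
columns of P X - B. *)
Lemma sqnorm_orthoproj (R : rcfType) (m p : nat) (P : 'M[R]_m)
    (X B : 'M[R]_(m, p)) :
  is_orthoproj P -> P *m B = B ->
  sqnorm (X - B) = sqnorm (X - P *m X) + sqnorm (P *m X - B).
Proof.
move=> [PT PP] PB.
have -> : X - B = (X - P *m X) + (P *m X - B) by rewrite addrA subrK.
have orth : (P *m X - B)^T *m (X - P *m X) = 0.
  rewrite -{1}PB -mulmxBr trmx_mul PT -mulmxA mulmxBr mulmxA PP subrr.
  by rewrite mulmx0.
have cross : \tr ((X - P *m X) *m (P *m X - B)^T) = 0.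
  by rewrite mxtrace_mulC orth mxtrace0.
have cross' : \tr ((P *m X - B) *m (X - P *m X)^T) = 0.
  by rewrite -mxtrace_tr trmx_mul trmxK.
move: (X - P *m X) (P *m X - B) cross cross' => Y Z cross cross'.
rewrite !sqnormE linearD mulmxDl !mulmxDr !mxtraceD /=.
by rewrite cross cross' addr0 add0r.
Qed.

Lemma sqnorm_sub_orthoproj (R : rcfType) (m p : nat) (P : 'M[R]_m)
    (X : 'M[R]_(m, p)) :
  is_orthoproj P -> sqnorm (X - P *m X) = sqnorm X - \tr (P *m (X *m X^T)).
Proof.
move=> hP; have [PT PP] := hP.
have := sqnorm_orthoproj X hP (mulmx0 p P).
rewrite !subr0 => ->.
rewrite [sqnorm (P *m X)]sqnormE trmx_mul PT !mulmxA.
by rewrite [\tr (_ *m P)]mxtrace_mulC !mulmxA PP addrK.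
Qed.

(** * Diagonalization of orthogonal projections *)

(** The Householder reflection in the hyperplane orthogonal to u - e_0 exchanges
u and e_0. *)
Lemma unit_first_column (R : rcfType) (n : nat) (u : 'cV[R]_(1 + n)) :
  u^T *m u = 1%:M ->
  exists2 H : 'M[R]_(1 + n), orthogonal_mx H & H *m delta_mx ord0 0 = u.
Proof.
move=> u1; pose e : 'cV[R]_(1 + n) := delta_mx ord0 0.
have ee : e^T *m e = 1%:M.
  rewrite /e trmx_delta mul_delta_mx; apply/matrixP=> i j.
  by rewrite !ord1 !mxE !eqxx.
case: (eqVneq u e) => [-> | ue].
  by exists 1%:M; rewrite /orthogonal_mx ?trmx1 mul1mx.
pose w := u - e; pose c := (w^T *m w) 0 0.
have wwE : w^T *m w = c%:M by rewrite [LHS]mx11_scalar.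
have ueE : e^T *m u = u^T *m e.
  by rewrite [RHS]mx11_scalar -tr_scalar_mx -mx11_scalar trmx_mul trmxK.
have cE : c = 2 - 2 * (u^T *m e) 0 0.
  rewrite /c /w [(u - e)^T]linearB /= mulmxBl !mulmxBr u1 ee ueE.
  by move: (u^T *m e) => d; rewrite !mxE eqxx mulr1n; ring.
have cN0 : c != 0.
  apply: contra_neq ue => c0; apply/eqP; rewrite -subr_eq0 -/w.
  apply/eqP/trmx_inj; rewrite trmx0; apply: sqnorm_eq0.
  by rewrite sqnormE trmxK wwE c0 mxtrace_scalar mul0rn.
pose H : 'M[R]_(1 + n) := 1%:M - (2 / c) *: (w *m w^T).
have HT : H^T = H by rewrite /H linearB /= trmx1 linearZ /= trmx_mul trmxK.
exists H.
  rewrite /orthogonal_mx HT /H mulmxBl mul1mx mulmxBr mulmx1.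
  rewrite -scalemxAl -scalemxAr mulmxA -(mulmxA w) wwE mul_mx_scalar.
  rewrite -scalemxAl !scalerA.
  by apply/matrixP=> i j; rewrite !mxE; field.
have wTe : w^T *m e = (- c / 2)%:M.
  rewrite [LHS]mx11_scalar; congr (_%:M).
  rewrite /w [(u - e)^T]linearB /= mulmxBl ee cE.
  by move: (u^T *m e) => d; rewrite !mxE eqxx mulr1n; field.
rewrite -/e /H mulmxBl mul1mx -scalemxAl -mulmxA wTe mul_mx_scalar scalerA.
have -> : 2 / c * (- c / 2) = -1 by field.
by rewrite scaleN1r opprK /w addrC subrK.
Qed.

(** Induction on the dimension: a unit vector u of the range of P is moved to
e_0 by a Householder reflection, after which P splits as a block 1 and a smaller
projection. *)
Lemma orthoproj_diag (R : rcfType) (n : nat) (P : 'M[R]_n) :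
  is_orthoproj P ->
  exists r (O : 'M[R]_n),
    [/\ (r <= n)%N, orthogonal_mx O & P = O *m pid_mx r *m O^T].
Proof.
elim: n P => [|n IHn] P projP.
  exists 0%N, 1%:M; split=> //; first by rewrite /orthogonal_mx trmx1 mul1mx.
  by rewrite [P]flatmx0 [RHS]flatmx0.
have [-> | /eqP P0] := eqVneq P 0.
  exists 0%N, 1%:M; split=> //; first by rewrite /orthogonal_mx trmx1 mul1mx.
  by rewrite pid_mx_0 mulmx0 mul0mx.
move: P projP P0; rewrite -[n.+1]/(1 + n)%N => P projP P0.
have [PT PP] := projP.
have [j vN0] : exists j, col j P != 0.
  apply/existsP; rewrite -negb_forall; apply/negP=> /forallP allP0.
  apply: P0; apply/matrixP=> i j.
  by have /eqP/matrixP/(_ i 0) := allP0 j; rewrite !mxE.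
pose v := col j P; pose c := sqnorm v.
have c_gt0 : 0 < c.
  rewrite lt_def sqnorm_ge0 andbT; apply: contra_neq vN0; exact: sqnorm_eq0.
have Pv : P *m v = v by rewrite /v colE mulmxA PP.
pose u := (Num.sqrt c)^-1 *: v.
have u1 : u^T *m u = 1%:M.
  rewrite /u [(_ *: v)^T]linearZ /= -scalemxAl -scalemxAr scalerA.
  rewrite [_ *m _]mx11_scalar -trace_mx11 -[v in _ *m v]trmxK.
  rewrite -sqnormE sqnorm_tr.
  rewrite scale_scalar_mx -invfM -expr2 sqr_sqrtr ?ltW //.
  by rewrite mulVf // gt_eqF.
have Pu : P *m u = u by rewrite /u -scalemxAr Pv.
have [H orthH He] := unit_first_column u1.
pose P1 := H^T *m P *m H.
have [P1T P1P1] : is_orthoproj P1.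
  by apply: orthoproj_compress => //; rewrite orthogonal_mxV // mul1mx.
have P1e : col ord0 P1 = delta_mx ord0 0.
  by rewrite colE /P1 -!mulmxA He Pu -He mulmxA orthH mul1mx.
have PE : P = H *m P1 *m H^T.
  rewrite /P1 !mulmxA orthogonal_mxV // mul1mx -mulmxA orthogonal_mxV //.
  by rewrite mulmx1.
clearbody P1.
have col0 i : P1 i ord0 = (i == ord0)%:R.
  by have /matrixP/(_ i 0) := P1e; rewrite !mxE eqxx andbT.
have row0 i : P1 ord0 i = (i == ord0)%:R by rewrite -P1T mxE col0.
have blockP1 : P1 = block_mx 1%:M 0 0 (drsubmx P1).
  have ord0E (i : 'I_1) : lshift n i = ord0 by apply/val_inj; rewrite /= ord1.
  rewrite -[LHS]submxK; congr block_mx; apply/matrixP=> i k; rewrite !mxE.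
  - by rewrite !ord0E col0 !ord1.
  - by rewrite ord0E row0.
  - by rewrite ord0E col0.
have [|r [O [rn orthO P2E]]] := IHn (drsubmx P1).
  split; first by rewrite trmx_drsub P1T.
  move: P1P1; rewrite blockP1 mulmx_block !(mul0mx, mulmx0, add0r, addr0).
  by rewrite mulmx1 block_mxKdr => /eq_block_mx [].
pose O1 : 'M[R]_(1 + n) := block_mx 1%:M 0 0 O.
have orthO1 : orthogonal_mx O1.
  rewrite /orthogonal_mx tr_block_mx mulmx_block !trmx0 trmx1.
  rewrite !(mul0mx, mulmx0, add0r, addr0) mulmx1 orthO.
  by rewrite -scalar_mx_block.
exists r.+1, (H *m O1); split=> //; first exact: orthogonal_mxM.
have pidE : pid_mx r.+1 = block_mx 1%:M 0 0 (pid_mx r) :> 'M[R]_(1 + n).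
  rewrite -[LHS]submxK; congr block_mx; apply/matrixP=> i k; rewrite !mxE //=.
  - by rewrite !ord1.
  - by rewrite !ord1.
  - by rewrite [k]ord1.
have P1E : P1 = O1 *m pid_mx r.+1 *m O1^T.
  rewrite blockP1 P2E pidE tr_block_mx !mulmx_block !trmx0 trmx1.
  by rewrite !(mul0mx, mulmx0, add0r, addr0) !mulmx1.
by rewrite trmx_mul !mulmxA -(mulmxA H) -(mulmxA H) -P1E.
Qed.

(** Both projections have the same diagonal form, because the trace is the
rank. *)
Lemma orthoproj_same_trace (R : rcfType) (n : nat) (P P' : 'M[R]_n) :
  is_orthoproj P -> is_orthoproj P' -> \tr P = \tr P' ->
  exists2 T : 'M[R]_n, orthogonal_mx T & P = T *m P' *m T^T.
Proof.
have tr_diag (O : 'M[R]_n) r : (r <= n)%N -> orthogonal_mx O ->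
    \tr (O *m pid_mx r *m O^T) = r%:R.
  by move=> rn orthO; rewrite mxtrace_mulC mulmxA orthO mul1mx mxtrace_pid.
move=> /orthoproj_diag[r [O [rn orthO ->]]].
move=> /orthoproj_diag[r' [O' [rn' orthO' ->]]].
rewrite !tr_diag // => /eqP; rewrite eqr_nat => /eqP <-.
exists (O *m O'^T); first exact/orthogonal_mxM/orthogonal_mxT.
by rewrite trmx_mul trmxK -!mulmxA !orthogonal_mxK.
Qed.

(** * Diagonal entries of an orthogonal projection as weights *)

Lemma orthoproj_diag_entry (R : rcfType) (m : nat) (P : 'M[R]_m) (i : 'I_m) :
  is_orthoproj P -> P i i = \sum_j P i j ^+ 2.
Proof.
case=> PT PP; rewrite -[in LHS]PP mxE; apply: eq_bigr => j _.
by rewrite -[in P j i]PT mxE expr2.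
Qed.

Lemma orthoproj_diag_entry_split (R : rcfType) (m : nat) (P : 'M[R]_m)
    (i : 'I_m) :
  is_orthoproj P -> P i i = P i i ^+ 2 + \sum_(j | j != i) P i j ^+ 2.
Proof. by move=> hP; rewrite [LHS]orthoproj_diag_entry // (bigD1 i). Qed.

(** A diagonal entry x satisfies x = x^2 + (a sum of squares). *)
Lemma orthoproj_diag_entry_itv (R : rcfType) (m : nat) (P : 'M[R]_m)
    (i : 'I_m) :
  is_orthoproj P -> 0 <= P i i <= 1.
Proof.
move=> hP; have := orthoproj_diag_entry_split i hP.
have : 0 <= \sum_(j | j != i) P i j ^+ 2.
  by apply: sumr_ge0 => j _; exact: sqr_ge0.
nra.
Qed.

(** When a diagonal entry is 0 or 1 it equals its own square, which leaves
nothing for the other entries of the row. *)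
Lemma orthoproj_row (R : rcfType) (m : nat) (P : 'M[R]_m) (b : bool)
    (i j : 'I_m) :
  is_orthoproj P -> P i i = b%:R -> P i j = (b && (i == j))%:R.
Proof.
move=> hP Pii; have [<- | ij] := eqVneq i j; first by rewrite andbT.
rewrite andbF; have := orthoproj_diag_entry_split i hP; rewrite Pii.
have -> : b%:R ^+ 2 = b%:R :> R by case: (b); rewrite ?expr1n ?expr0n.
rewrite -[LHS]addr0 => /addrI/esym sum0.
apply/eqP; rewrite -sqrf_eq0; apply/eqP.
by apply: (psumr_eq0P _ sum0) => [k _|]; rewrite ?sqr_ge0 // eq_sym.
Qed.

Lemma antitone_threshold (R : rcfType) (m k : nat) (s : 'I_m -> R) :
  (k <= m)%N -> (forall i, 0 <= s i) ->
  (forall i j : 'I_m, (i <= j)%N -> s j <= s i) ->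
  exists t, forall i : 'I_m, if (i < k)%N then t <= s i else s i <= t.
Proof.
case: k => [|k] km s_ge0 s_anti.
  (* With k = 0 any upper bound of s serves as threshold. *)
  exists (\sum_i s i) => i; rewrite ltn0 (bigD1 i) //= lerDl.
  by apply: sumr_ge0.
(* The smallest of the first k.+1 values. *)
exists (s (Ordinal km)) => i; case: ifPn => ik; apply: s_anti => //=.
by rewrite leqNgt; apply: contra ik => /ltnW.
Qed.

(** With t separating the first k values of s from the others, the difference
of the two sums is the sum of ((i < k) - w_i) (s_i - t), because both weight
systems have total k; every term is nonnegative. *)
Lemma weighted_sum_le_head (R : rcfType) (m k : nat) (s w : 'I_m -> R) :
  (k <= m)%N -> (forall i, 0 <= s i) ->
  (forall i j : 'I_m, (i <= j)%N -> s j <= s i) ->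
  (forall i, 0 <= w i <= 1) -> \sum_i w i = k%:R ->
  \sum_i w i * s i <= \sum_(i < m) (i < k)%:R * s i /\
  (\sum_i w i * s i = \sum_(i < m) (i < k)%:R * s i ->
   exists t, forall i : 'I_m, s i != t -> w i = (i < k)%:R).
Proof.
move=> km s_ge0 s_anti w_itv sum_w.
have [t tP] := antitone_threshold km s_ge0 s_anti.
have sum_k : \sum_(i < m) (i < k)%:R = k%:R :> R.
  by rewrite -(mxtrace_pid R km); apply: eq_bigr => i _; rewrite mxE eqxx.
have gapE : \sum_(i < m) (i < k)%:R * s i - \sum_i w i * s i =
    \sum_(i < m) ((i < k)%:R - w i) * (s i - t).
  under [RHS]eq_bigr => i _ do rewrite mulrBr mulrBl.
  by rewrite !sumrB -mulr_suml sumrB sum_k sum_w subrr mul0r subr0.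
have term_ge0 (i : 'I_m) : 0 <= ((i < k)%:R - w i) * (s i - t).
  have := tP i; have /andP[] := w_itv i.
  by case: ifP => _; rewrite /=; nra.
split; first by rewrite -subr_ge0 gapE; apply: sumr_ge0.
move=> sum_eq; exists t => i sNt; apply/esym/eqP.
have gap0 : \sum_(i < m) ((i < k)%:R - w i) * (s i - t) = 0.
  by rewrite -gapE sum_eq subrr.
have /eqP : ((i < k)%:R - w i) * (s i - t) = 0.
  by apply: (psumr_eq0P _ gap0) => // j _.
by rewrite mulf_eq0 [X in _ || X]subr_eq0 (negPf sNt) orbF subr_eq0.
Qed.

(** * Singular value decompositions and their truncations *)

Definition svd_trunc (R : rcfType) (m p k : nat) (hm : (k <= m)%N)
    (hp : (k <= p)%N) (U : 'M[R]_m) (S : 'M[R]_(m, p)) (V : 'M[R]_p) :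
    'M[R]_(m, p) :=
  first_cols hm U *m mxsub (widen_ord hm) (widen_ord hp) S *m
    (first_cols hp V)^T.

Lemma is_svd_tr (R : rcfType) (m p : nat) (X : 'M[R]_(m, p)) U S V :
  is_svd X U S V -> is_svd X^T V S^T U.
Proof.
case=> -[orthU orthV] diagS S_ge0 S_anti XE; split=> //.
- by rewrite is_diag_trmx.
- by move=> i j; rewrite mxE.
- move=> i i' j j' ij ij' ii'; rewrite !mxE; apply: S_anti => //.
  by rewrite -ij -ij'.
- by rewrite XE !trmx_mul trmxK mulmxA.
Qed.

Lemma svd_trunc_tr (R : rcfType) (m p k : nat) (hm : (k <= m)%N)
    (hp : (k <= p)%N) (U : 'M[R]_m) (S : 'M[R]_(m, p)) (V : 'M[R]_p) :
  (svd_trunc hm hp U S V)^T = svd_trunc hp hm V S^T U.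
Proof.
by rewrite /svd_trunc !trmx_mul trmxK trmx_mxsub mulmxA.
Qed.

Lemma pid_diag_mx (R : rcfType) (m k : nat) :
  pid_mx k = diag_mx (\row_i (i < k)%:R) :> 'M[R]_m.
Proof.
apply/matrixP=> i j; rewrite !mxE; have [<-|ij] := eqVneq i j.
  by rewrite eqxx.
by rewrite -val_eqE /= in ij *; rewrite (negPf ij).
Qed.

Lemma pid_mul_diag (R : rcfType) (m p k : nat) (S : 'M[R]_(m, p)) :
  is_diag_mx S -> pid_mx k *m S = S *m pid_mx k.
Proof.
move=> diagS; rewrite !pid_diag_mx mul_diag_mx mul_mx_diag.
apply/matrixP=> i j; rewrite !mxE mulrC.
have [ij|ij] := eqVneq (i : nat) j; first by rewrite ij.
by rewrite (is_diag_mxP diagS) // !mul0r.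
Qed.

Lemma first_colsE (R : rcfType) (m p k : nat) (hk : (k <= p)%N)
    (X : 'M[R]_(m, p)) :
  first_cols hk X = X *m pid_mx k.
Proof.
rewrite /first_cols -[X in colsub _ X]mulmx1 -mulmx_colsub; congr (_ *m _).
apply/matrixP=> i j; rewrite !mxE -val_eqE /=.
have [->|] := eqVneq (i : nat) j => //.
by rewrite ltn_ord.
Qed.

(** Truncating an SVD is the same as projecting X onto the first k left
singular vectors, so a truncation can be compared with any other P X. *)
Lemma svd_truncE (R : rcfType) (m p k : nat) (hm : (k <= m)%N)
    (hp : (k <= p)%N) (X : 'M[R]_(m, p)) U S V :
  is_svd X U S V -> svd_trunc hm hp U S V = U *m pid_mx k *m U^T *m X.
Proof.
case=> -[orthU orthV] diagS S_ge0 S_anti ->.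
rewrite -!mulmxA orthogonal_mxK // /svd_trunc.
have -> : mxsub (widen_ord hm) (widen_ord hp) S = pid_mx k *m (S *m pid_mx k).
  rewrite -first_colsE -[RHS]trmxK trmx_mul tr_pid_mx -first_colsE.
  by apply/matrixP=> i j; rewrite !mxE.
rewrite !first_colsE trmx_mul tr_pid_mx -!mulmxA; congr (_ *m _).
rewrite [pid_mx k *m (pid_mx k *m V^T)]mulmxA pid_mx_id //.
by rewrite [S *m (_ *m V^T)]mulmxA -pid_mul_diag // !mulmxA !pid_mx_id.
Qed.

Lemma svd_gram_diag (R : rcfType) (m p : nat) (S : 'M[R]_(m, p)) :
  is_diag_mx S -> S *m S^T = diag_mx (\row_i (S *m S^T) i i).
Proof.
move=> diagS; apply/matrixP=> i i'.
rewrite [RHS]mxE [X in X *+ _]mxE; have [<-|ii'] := eqVneq i i'; first by [].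
rewrite mxE big1 // => j _; rewrite mxE.
have [ij|ij] := eqVneq (i : nat) j; last by rewrite (is_diag_mxP diagS) ?mul0r.
by rewrite [S i' j](is_diag_mxP diagS) ?mulr0 // -ij eq_sym.
Qed.

Lemma svd_gram_entry (R : rcfType) (m p : nat) (S : 'M[R]_(m, p))
    (i : 'I_m) (j : 'I_p) :
  is_diag_mx S -> i = j :> nat -> (S *m S^T) i i = S i j ^+ 2.
Proof.
move=> diagS ij; rewrite mxE (bigD1 j) //= big1 ?addr0; last first.
  move=> l lj; rewrite (is_diag_mxP diagS) ?mul0r // ij eq_sym.
  by apply: contra lj => /eqP/val_inj->.
by rewrite mxE expr2.
Qed.

Lemma svd_gram_ge0 (R : rcfType) (m p : nat) (S : 'M[R]_(m, p)) (i : 'I_m) :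
  0 <= (S *m S^T) i i.
Proof. by rewrite mxE; apply: sumr_ge0 => j _; rewrite mxE -expr2 sqr_ge0. Qed.

Lemma svd_gram_out (R : rcfType) (m p : nat) (S : 'M[R]_(m, p)) (i : 'I_m) :
  is_diag_mx S -> (p <= i)%N -> (S *m S^T) i i = 0.
Proof.
move=> diagS pi; rewrite mxE big1 // => j _.
by rewrite (is_diag_mxP diagS) ?mul0r // gtn_eqF // (leq_trans (ltn_ord j)).
Qed.

Lemma svd_gram_antitone (R : rcfType) (m p : nat) (X : 'M[R]_(m, p)) U S V
    (i i' : 'I_m) :
  is_svd X U S V -> (i <= i')%N -> (S *m S^T) i' i' <= (S *m S^T) i i.
Proof.
case=> _ diagS S_ge0 S_anti _ ii'.
have [pi'|i'p] := leqP p i'; first by rewrite svd_gram_out // svd_gram_ge0.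
have ip : (i < p)%N := leq_ltn_trans ii' i'p.
rewrite (@svd_gram_entry _ _ _ _ i (Ordinal ip)) //.
rewrite (@svd_gram_entry _ _ _ _ i' (Ordinal i'p)) //.
by rewrite ler_pXn2r ?nnegrE //; exact: S_anti.
Qed.

(** In the basis U, the Gram matrix X X^T becomes the diagonal S S^T. *)
Lemma mxtrace_orthoproj_gram (R : rcfType) (m p : nat) (X : 'M[R]_(m, p)) U S V
    (P : 'M[R]_m) :
  is_svd X U S V ->
  \tr (P *m (X *m X^T)) = \sum_i (U^T *m P *m U) i i * (S *m S^T) i i.
Proof.
case=> -[_ orthV] diagS _ _ ->.
have -> : U *m S *m V^T *m (U *m S *m V^T)^T = U *m (S *m S^T) *m U^T.
  by rewrite !trmx_mul trmxK -!mulmxA orthogonal_mxK.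
rewrite [X in U *m X *m _]svd_gram_diag // mulmxA mxtrace_mulC 2!mulmxA.
rewrite mulmxA mul_mx_diag.
by apply: eq_bigr => i _; rewrite [LHS]mxE [X in _ * X]mxE.
Qed.

(** * Rotations inside the span of a frame *)

Lemma frame_complement (R : rcfType) (m d : nat) (G : 'M[R]_(m, d)) :
  G^T *m G = 1%:M ->
  [/\ (1%:M - G *m G^T) *m G = 0, G^T *m (1%:M - G *m G^T) = 0 &
      is_orthoproj (1%:M - G *m G^T)].
Proof.
move=> GG.
have FG : (1%:M - G *m G^T) *m G = 0.
  by rewrite mulmxBl mul1mx -mulmxA GG mulmx1 subrr.
have FT : (1%:M - G *m G^T)^T = 1%:M - G *m G^T.
  by rewrite linearB /= trmx1 trmx_mul trmxK.
split=> //; first by rewrite -[LHS]trmxK trmx_mul FT trmxK FG trmx0.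
by split=> //; rewrite mulmxBr mulmx1 mulmxA FG mul0mx subr0.
Qed.

(** For orthonormal columns G, the matrix that acts as T in the coordinates
given by G, and as the identity on the orthogonal complement. *)
Definition frame_extend (R : rcfType) (m d : nat) (G : 'M[R]_(m, d))
    (T : 'M[R]_d) : 'M[R]_m :=
  1%:M - G *m G^T + G *m T *m G^T.

Lemma frame_extend_orthogonal (R : rcfType) (m d : nat) (G : 'M[R]_(m, d))
    (T : 'M[R]_d) :
  G^T *m G = 1%:M -> orthogonal_mx T -> orthogonal_mx (frame_extend G T).
Proof.
move=> GG orthT; have [FG GF [FT FF]] := frame_complement GG.
rewrite /orthogonal_mx /frame_extend.
have split1 : 1%:M = (1%:M - G *m G^T) + G *m G^T by rewrite subrK.
move: (1%:M - G *m G^T) FG GF FT FF split1 => F FG GF FT FF split1.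
rewrite [(F + _)^T]linearD /= FT !trmx_mul trmxK.
rewrite mulmxDl !mulmxDr FF !mulmxA FG !mul0mx addr0.
rewrite -!mulmxA GF !mulmx0 add0r [G^T *m (G *m _)]mulmxA GG mul1mx.
by rewrite [T^T *m _]mulmxA orthT mul1mx -split1.
Qed.

(** Both projections respect the splitting into the range of G and its
complement, and they coincide on the complement; so their compressions to the
range of G are projections of equal trace, conjugate by some T. *)
Lemma orthoproj_same_trace_frame (R : rcfType) (m d : nat) (G : 'M[R]_(m, d))
    (P P' : 'M[R]_m) :
  G^T *m G = 1%:M -> is_orthoproj P -> is_orthoproj P' -> \tr P = \tr P' ->
  P *m (1%:M - G *m G^T) = P' *m (1%:M - G *m G^T) ->
  (1%:M - G *m G^T) *m P' *m G = 0 ->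
  exists2 T : 'M[R]_d, orthogonal_mx T &
    P = frame_extend G T *m P' *m (frame_extend G T)^T.
Proof.
move=> GG projP projP' trPP'; have [FG GF [FT FF]] := frame_complement GG.
set F := 1%:M - _ in FG GF FT FF * => PF FP'G.
have [PT _] := projP; have [P'T _] := projP'.
have FP : F *m P = F *m P' by rewrite -FT -PT -P'T -!trmx_mul PF.
have FPG : F *m P *m G = 0 by rewrite FP.
have GPF (P0 : 'M[R]_m) : P0^T = P0 -> F *m P0 *m G = 0 -> G^T *m P0 *m F = 0.
  by move=> P0T /(congr1 trmx); rewrite !trmx_mul FT P0T mulmxA trmx0.
have split1 : 1%:M = F + G *m G^T by rewrite subrK.
have compress (P0 : 'M[R]_m) : F *m P0 *m G = 0 -> is_orthoproj P0 ->
    is_orthoproj (G^T *m P0 *m G).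
  move=> FP0G; apply: orthoproj_compress.
  by rewrite -[in RHS](mul1mx P0) [in RHS]split1 mulmxDl mulmxDl FP0G add0r.
have trE (P0 : 'M[R]_m) : \tr (G^T *m P0 *m G) = \tr P0 - \tr (P0 *m F).
  rewrite -mulmxA mxtrace_mulC -mulmxA /F mulmxBr mulmx1.
  by rewrite [\tr (_ - _)]linearB /= opprB addrC subrK.
have [||| T orthT TE] :=
  @orthoproj_same_trace _ _ (G^T *m P *m G) (G^T *m P' *m G).
- exact: compress.
- exact: compress.
- by rewrite !trE trPP' PF.
exists T => //.
have -> : frame_extend G T = F + G *m T *m G^T by [].
clearbody F; rewrite -[LHS]mul1mx -[LHS]mulmx1 [in LHS]split1.
rewrite [(F + _)^T]linearD /= FT !trmx_mul trmxK !mulmxDr !mulmxDl.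
have -> : F *m P *m (G *m G^T) = 0 by rewrite mulmxA FPG mul0mx.
have -> : G *m G^T *m P *m F = 0.
  by rewrite -!mulmxA [G^T *m _]mulmxA (GPF P) // mulmx0.
have -> : F *m P' *m (G *m (T^T *m G^T)) = 0.
  by rewrite [_ *m (G *m _)]mulmxA FP'G mul0mx.
have -> : G *m T *m G^T *m P' *m F = 0.
  by rewrite -!mulmxA [G^T *m (P' *m F)]mulmxA (GPF P') // !mulmx0.
rewrite !addr0 !add0r FP; congr (_ + _).
rewrite -!mulmxA; congr (_ *m _); rewrite !mulmxA; congr (_ *m _).
by rewrite TE !mulmxA.
Qed.

(** The left and right coordinate axes that belong to the singular value sqrt t
are exchanged by S and S^T up to the factor sqrt t, so rotating the left ones by
some T is compensated by rotating the right ones by the same T.  The assumption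
t != 0 ensures that each left axis has a right partner: for t = 0 there may be
more left axes than right ones. *)
Lemma svd_level_rotation (R : rcfType) (m p : nat) (X : 'M[R]_(m, p)) U S V
    (P : 'M[R]_m) (k : nat) (t : R) :
  is_svd X U S V -> (k <= m)%N -> is_orthoproj P -> \tr P = k%:R -> t != 0 ->
  (forall i, (S *m S^T) i i != t -> P i i = (i < k)%:R) ->
  exists (O : 'M[R]_m) (O' : 'M[R]_p),
    [/\ orthogonal_mx O, orthogonal_mx O', O *m S = S *m O' &
        P = O *m pid_mx k *m O^T].
Proof.
move=> svdX km projP trP tN0 Pii; have [_ diagS S_ge0 _ _] := svdX.
pose I := [set i | (S *m S^T) i i == t].
pose f (a : 'I_#|I|) : 'I_m := enum_val a.
have fI a : (S *m S^T) (f a) (f a) = t.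
  by have := enum_valP a; rewrite inE => /eqP.
have fp a : (f a < p)%N.
  by rewrite ltnNge; apply: contra tN0 => ?; rewrite -(fI a) svd_gram_out.
pose g a : 'I_p := Ordinal (fp a).
have f_inj : injective f := enum_val_inj.
have g_inj : injective g by move=> a b /(congr1 val)/= /val_inj/f_inj.
pose G : 'M[R]_(m, #|I|) := colsub f 1%:M.
pose G' : 'M[R]_(p, #|I|) := colsub g 1%:M.
have frame q (h : 'I_#|I| -> 'I_q) : injective h ->
    (colsub h 1%:M)^T *m colsub h 1%:M = 1%:M :> 'M[R]_#|I|.
  move=> h_inj; rewrite trmx_mxsub trmx1 mul_rowsub_mx mul1mx.
  by apply/matrixP=> a b; rewrite !mxE (inj_eq h_inj).
have GG : G^T *m G = 1%:M by exact: frame.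
have GG' : G'^T *m G' = 1%:M by exact: frame.
have FE : 1%:M - G *m G^T = diag_mx (\row_i (i \notin I)%:R).
  have -> : G *m G^T = diag_mx (\row_i (i \in I)%:R).
    apply/matrixP=> i j; rewrite mxE [RHS]mxE [X in X *+ _]mxE.
    have [iI|iNI] := boolP (i \in I); last first.
      rewrite mul0rn big1 // => a _; rewrite mxE [X in X * _]mxE.
      case: eqP => [iE|_]; last by rewrite mul0r.
      by rewrite iE enum_valP in iNI.
    have fi : f (enum_rank_in iI i) = i by rewrite /f enum_rankK_in.
    rewrite (bigD1 (enum_rank_in iI i)) //= big1 ?addr0 => [|a ai].
      by rewrite mxE [X in X * _]mxE fi !mxE fi eqxx mul1r eq_sym.
    rewrite mxE [X in X * _]mxE -{1}fi (inj_eq f_inj) eq_sym (negPf ai).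
    by rewrite mul0r.
  apply/matrixP=> i j; rewrite !mxE -mulrnBl.
  by case: (i \in I); rewrite ?subrr ?subr0.
have [||| T orthT PE] :=
  orthoproj_same_trace_frame GG projP (pid_orthoproj R km).
- by rewrite trP mxtrace_pid.
- rewrite FE !mul_mx_diag; apply/matrixP=> i j.
  rewrite [LHS]mxE [RHS]mxE [X in _ * X = _]mxE [X in _ = _ * X]mxE.
  have [|] := boolP (j \in I); first by rewrite !mulr0.
  rewrite inE => /Pii Pjj.
  congr (_ * _); have [PT _] := projP.
  rewrite -PT mxE (orthoproj_row _ projP Pjj) mxE andbC eq_sym val_eqE.
  by have [->|] := eqVneq.
- have [FG _ _] := frame_complement GG.
  by rewrite FE pid_diag_mx diag_mxC -mulmxA -FE FG mulmx0.
exists (frame_extend G T), (frame_extend G' T).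
split; [exact: frame_extend_orthogonal | exact: frame_extend_orthogonal | |
        by []].
have S_on a j : S (f a) j = Num.sqrt t * (j == g a)%:R.
  rewrite -val_eqE /= eq_sym; have [faj|faj] := eqVneq (f a : nat) j.
    by rewrite -(fI a) (svd_gram_entry diagS faj) sqrtr_sqr ger0_norm ?mulr1.
  by rewrite (is_diag_mxP diagS) ?mulr0.
have GS : G^T *m S = Num.sqrt t *: G'^T.
  rewrite trmx_mxsub trmx1 mul_rowsub_mx mul1mx; apply/matrixP=> a j.
  by rewrite !mxE S_on.
have SG : S *m G' = Num.sqrt t *: G.
  rewrite mulmx_colsub mulmx1; apply/matrixP=> i a; rewrite !mxE.
  have [->|ia] := eqVneq i (f a); first by rewrite S_on eqxx.
  by rewrite (is_diag_mxP diagS) ?mulr0.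
rewrite /frame_extend mulmxDl mulmxDr mulmxBl mulmxBr mul1mx mulmx1.
by rewrite -!mulmxA GS !mulmxA SG -!scalemxAl -!scalemxAr.
Qed.

(** * The Eckart--Young theorem with its equality case *)

(** Only approximations P X with P a projection are compared here; the
equality case produces an SVD adapted to P by rotating (U, V) inside one
singular space. *)
Theorem eckart_young_orthoproj (R : rcfType) (m p k : nat) (hm : (k <= m)%N)
    (hp : (k <= p)%N) (X : 'M[R]_(m, p)) U S V (P : 'M[R]_m) :
  is_svd X U S V -> is_orthoproj P -> \tr P = k%:R ->
  sqnorm (X - svd_trunc hm hp U S V) <= sqnorm (X - P *m X) /\
  (sqnorm (X - svd_trunc hm hp U S V) = sqnorm (X - P *m X) ->
   exists U' S' V', is_svd X U' S' V' /\ P *m X = svd_trunc hm hp U' S' V').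
Proof.
move=> svdX projP trP; have [[orthU orthV] diagS S_ge0 S_anti XE] := svdX.
pose Pt := U^T *m P *m U.
have projPt : is_orthoproj Pt.
  by apply: orthoproj_compress => //; rewrite orthogonal_mxV // mul1mx.
have trPt : \tr Pt = k%:R.
  by rewrite /Pt mxtrace_mulC mulmxA orthogonal_mxV // mul1mx.
have PE : P = U *m Pt *m U^T.
  by rewrite /Pt -!mulmxA orthogonal_mxVK // orthogonal_mxV // mulmx1.
have trPX : \tr (P *m (X *m X^T)) = \sum_i Pt i i * (S *m S^T) i i.
  exact: mxtrace_orthoproj_gram svdX.
clearbody Pt; pose E := U *m pid_mx k *m U^T.
have EtE : U^T *m E *m U = pid_mx k.
  by rewrite /E -!mulmxA orthogonal_mxK // orthU mulmx1.
have projE : is_orthoproj E.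
  have := @orthoproj_compress _ _ _ U^T (pid_mx k).
  by rewrite trmxK orthU mul1mx; apply=> //; exact: pid_orthoproj.
have trE : \tr (E *m (X *m X^T)) = \sum_(i < m) (i < k)%:R * (S *m S^T) i i.
  rewrite (mxtrace_orthoproj_gram _ svdX) EtE; apply: eq_bigr => i _.
  by rewrite !mxE eqxx.
have [] := @weighted_sum_le_head _ _ k (fun i => (S *m S^T) i i)
  (fun i => Pt i i) hm.
- exact: svd_gram_ge0.
- by move=> i j; apply: svd_gram_antitone svdX.
- by move=> i; apply: orthoproj_diag_entry_itv.
- exact: trPt.
rewrite (svd_truncE hm hp svdX) -/E !sqnorm_sub_orthoproj //.
rewrite trPX -trE => le_tr eq_tr.
split=> [|/addrI/oppr_inj/esym/eq_tr [t tP]]; first by rewrite lerD2l lerN2.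
have [t0|tN0] := eqVneq t 0.
  (* Where the two projections may differ, the row of S vanishes. *)
  exists U, S, V; split=> //; rewrite (svd_truncE hm hp svdX).
  rewrite PE XE -!mulmxA !orthogonal_mxK //; congr (_ *m _).
  rewrite [Pt *m (S *m _)]mulmxA [RHS]mulmxA; congr (_ *m _).
  apply/matrixP=> i j; rewrite [LHS]mxE [RHS]mxE; apply: eq_bigr => l _.
  have [sl0|slN0] := eqVneq ((S *m S^T) l l) 0.
    have [lj|lj] := eqVneq (l : nat) j; last first.
      by rewrite (is_diag_mxP diagS) ?mulr0.
    move: sl0; rewrite (svd_gram_entry diagS lj) => /eqP.
    by rewrite sqrf_eq0 => /eqP->; rewrite !mulr0.
  have [PtT _] := projPt; rewrite -t0 in slN0.
  rewrite -PtT mxE (orthoproj_row _ projPt (tP _ slN0)) mxE; congr (_%:R * _).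
  by rewrite andbC eq_sym val_eqE; have [->|] := eqVneq.
have [O [O' [orthO orthO' OS PtE]]] :=
  svd_level_rotation svdX hm projPt trPt tN0 tP.
have svdX' : is_svd X (U *m O) S (V *m O').
  split=> //; first by split; apply: orthogonal_mxM.
  rewrite -(mulmxA U) OS trmx_mul -!mulmxA orthogonal_mxVK //.
  by rewrite mulmxA.
exists (U *m O), S, (V *m O'); split=> //.
rewrite (svd_truncE hm hp svdX') PE PtE trmx_mul.
by rewrite !mulmxA.
Qed.

(** By Pythagoras, P X is the best approximation among the matrices whose
columns lie in the range of P. *)
Corollary eckart_young_left (R : rcfType) (m p k : nat) (hm : (k <= m)%N)
    (hp : (k <= p)%N) (X B : 'M[R]_(m, p)) U S V (P : 'M[R]_m) :
  is_svd X U S V -> is_orthoproj P -> \tr P = k%:R -> P *m B = B ->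
  sqnorm (X - svd_trunc hm hp U S V) <= sqnorm (X - B) /\
  (sqnorm (X - svd_trunc hm hp U S V) = sqnorm (X - B) ->
   exists U' S' V', is_svd X U' S' V' /\ B = svd_trunc hm hp U' S' V').
Proof.
move=> svdX projP trP PB.
have [le_proj eq_proj] := eckart_young_orthoproj hm hp svdX projP trP.
have pyth := sqnorm_orthoproj X projP PB; have := sqnorm_ge0 (P *m X - B).
rewrite pyth => B_ge0; split=> [|eqXB]; first by lra.
have B0 : sqnorm (P *m X - B) = 0 by lra.
have -> : B = P *m X by apply/esym/eqP; rewrite -subr_eq0 (sqnorm_eq0 B0).
by apply: eq_proj; lra.
Qed.

Corollary eckart_young_right (R : rcfType) (m p k : nat) (hm : (k <= m)%N)
    (hp : (k <= p)%N) (X B : 'M[R]_(m, p)) U S V (P : 'M[R]_p) :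
  is_svd X U S V -> is_orthoproj P -> \tr P = k%:R -> B *m P = B ->
  sqnorm (X - svd_trunc hm hp U S V) <= sqnorm (X - B) /\
  (sqnorm (X - svd_trunc hm hp U S V) = sqnorm (X - B) ->
   exists U' S' V', is_svd X U' S' V' /\ B = svd_trunc hm hp U' S' V').
Proof.
move=> svdX projP trP BP; have [PT _] := projP.
have PBT : P *m B^T = B^T by rewrite -{1}PT -trmx_mul BP.
have := eckart_young_left hp hm (is_svd_tr svdX) projP trP PBT.
rewrite -svd_trunc_tr -!linearB /= !sqnorm_tr => -[le_tr eq_tr].
split=> // /eq_tr [V' [S' [U' [svdX' BE]]]].
exists U', S'^T, V'; split; first by rewrite -[X]trmxK; exact: is_svd_tr.
by rewrite -[B]trmxK BE svd_trunc_tr.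
Qed.

(** * Mode products, t-products and frontal slices *)

Lemma mode1_slice (R : rcfType) (m p n a : nat) (A : tensor R m p n)
    (F : 'M[R]_(a, m)) k :
  mode1 A F k = F *m A k.
Proof. by apply/matrixP=> i j; rewrite ffunE !mxE. Qed.

Lemma mode2_slice (R : rcfType) (m p n b : nat) (A : tensor R m p n)
    (F : 'M[R]_(b, p)) k :
  mode2 A F k = A k *m F^T.
Proof.
apply/matrixP=> i j; rewrite ffunE !mxE; apply: eq_bigr => l _.
by rewrite mxE mulrC.
Qed.

Lemma mode3_slice (R : rcfType) (m p n c : nat) (A : tensor R m p n)
    (F : 'M[R]_(c, n)) r :
  mode3 A F r = \sum_k F r k *: A k.
Proof.
apply/matrixP=> i j; rewrite ffunE mxE summxE; apply: eq_bigr => k _.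
by rewrite mxE.
Qed.

Lemma mode3_mode3 (R : rcfType) (m p n c d : nat) (A : tensor R m p n)
    (F : 'M[R]_(c, n)) (G : 'M[R]_(d, c)) :
  mode3 (mode3 A F) G = mode3 A (G *m F).
Proof.
apply/ffunP=> r; rewrite !mode3_slice.
under eq_bigr => l _ do rewrite mode3_slice scaler_sumr.
rewrite exchange_big /=; apply: eq_bigr => k _; rewrite mxE scaler_suml.
by apply: eq_bigr => l _; rewrite scalerA.
Qed.

Lemma mode3_1 (R : rcfType) (m p n : nat) (A : tensor R m p n) :
  mode3 A 1%:M = A.
Proof.
apply/ffunP=> r; rewrite mode3_slice (bigD1 r) //= big1 => [|k kr].
  by rewrite addr0 mxE eqxx scale1r.
by rewrite mxE eq_sym (negPf kr) scale0r.
Qed.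

Lemma mode3K (R : rcfType) (m p n : nat) (A : tensor R m p n) (M : 'M[R]_n) :
  M \in unitmx -> mode3 (mode3 A M) (invmx M) = A.
Proof. by move=> uM; rewrite mode3_mode3 mulVmx // mode3_1. Qed.

Lemma mode3KV (R : rcfType) (m p n : nat) (A : tensor R m p n) (M : 'M[R]_n) :
  M \in unitmx -> mode3 (mode3 A (invmx M)) M = A.
Proof. by move=> uM; rewrite mode3_mode3 mulmxV // mode3_1. Qed.

Lemma mode3_sub (R : rcfType) (m p n c : nat) (A B : tensor R m p n)
    (F : 'M[R]_(c, n)) r :
  mode3 (A - B) F r = mode3 A F r - mode3 B F r.
Proof.
rewrite !mode3_slice -sumrB; apply: eq_bigr => k _.
by rewrite !ffunE scalerBr.
Qed.

Lemma mode3_mulmxl (R : rcfType) (m l p n c : nat) (A : tensor R m p n)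
    (P : 'M[R]_(l, m)) (F : 'M[R]_(c, n)) r :
  mode3 [ffun k => P *m A k] F r = P *m mode3 A F r.
Proof.
rewrite !mode3_slice mulmx_sumr; apply: eq_bigr => k _.
by rewrite ffunE scalemxAr.
Qed.

Lemma mode3_mulmxr (R : rcfType) (m l p n c : nat) (A : tensor R m p n)
    (P : 'M[R]_(p, l)) (F : 'M[R]_(c, n)) r :
  mode3 [ffun k => A k *m P] F r = mode3 A F r *m P.
Proof.
rewrite !mode3_slice mulmx_suml; apply: eq_bigr => k _.
by rewrite ffunE scalemxAl.
Qed.

Lemma fnormE (R : rcfType) (m p n : nat) (A : tensor R m p n) :
  fnorm A = Num.sqrt (\sum_k sqnorm (A k)).
Proof.
congr Num.sqrt; rewrite /sqnorm exchange_big /=.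
under [LHS]eq_bigr => j _ do rewrite exchange_big.
rewrite exchange_big /=; apply: eq_bigr => k _.
by rewrite exchange_big.
Qed.

Lemma sqnorm_orthogonal (R : rcfType) (n q : nat) (F : 'M[R]_n)
    (X : 'M[R]_(n, q)) :
  orthogonal_mx F -> sqnorm (F *m X) = sqnorm X.
Proof.
move=> orthF; rewrite -[LHS]sqnorm_tr -[RHS]sqnorm_tr !sqnormE !trmxK.
by rewrite trmx_mul -mulmxA orthogonal_mxK.
Qed.

Lemma fnorm_mode3 (R : rcfType) (m p n : nat) (A : tensor R m p n)
    (F : 'M[R]_n) :
  orthogonal_mx F -> fnorm (mode3 A F) = fnorm A.
Proof.
move=> orthF; congr Num.sqrt; apply: eq_bigr => i _; apply: eq_bigr => j _.
have := sqnorm_orthogonal (\col_k A k i j) orthF.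
rewrite /sqnorm; under eq_bigr do rewrite big_ord1.
under [RHS]eq_bigr do rewrite big_ord1 mxE.
move=> <-; apply: eq_bigr => r _; congr (_ ^+ 2); rewrite ffunE !mxE.
by apply: eq_bigr => k _; rewrite mxE.
Qed.

Lemma fnorm_sub_slices (R : rcfType) (m p n : nat) (A B : tensor R m p n)
    (F : 'M[R]_n) :
  orthogonal_mx F ->
  fnorm (A - B) = Num.sqrt (\sum_r sqnorm (mode3 A F r - mode3 B F r)).
Proof.
move=> orthF; rewrite -(fnorm_mode3 _ orthF) fnormE.
by congr Num.sqrt; apply: eq_bigr => r _; rewrite mode3_sub.
Qed.

Lemma starM_slice (R : rcfType) (m l p n : nat) (M : 'M[R]_n)
    (A : tensor R m l n) (B : tensor R l p n) r :
  M \in unitmx -> mode3 (starM M A B) M r = mode3 A M r *m mode3 B M r.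
Proof. by move=> uM; rewrite /starM mode3KV // ffunE. Qed.

Lemma trM_slice (R : rcfType) (m p n : nat) (M : 'M[R]_n)
    (A : tensor R m p n) r :
  M \in unitmx -> mode3 (trM M A) M r = (mode3 A M r)^T.
Proof. by move=> uM; rewrite /trM mode3KV // ffunE. Qed.

Lemma mode3_mxsub (R : rcfType) (m p m' p' n c : nat) (f : 'I_m' -> 'I_m)
    (g : 'I_p' -> 'I_p) (A : tensor R m p n) (F : 'M[R]_(c, n)) r :
  mode3 [ffun k => mxsub f g (A k)] F r = mxsub f g (mode3 A F r).
Proof.
apply/matrixP=> i j; rewrite !(ffunE, mxE).
by apply: eq_bigr => k _; rewrite ffunE mxE.
Qed.

Lemma tsvdm_trunc_slice (R : rcfType) (m p n k : nat) (hm : (k <= m)%N)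
    (hp : (k <= p)%N) (M : 'M[R]_n) (U : tensor R m m n) (S : tensor R m p n)
    (V : tensor R p p n) r :
  M \in unitmx ->
  mode3 (tsvdm_trunc hm hp M U S V) M r =
  svd_trunc hm hp (mode3 U M r) (mode3 S M r) (mode3 V M r).
Proof.
by move=> uM; rewrite /tsvdm_trunc !starM_slice // trM_slice // !mode3_mxsub.
Qed.

(** Over an invertible M the transform A |-> mode3 A M is a bijection turning
star-M products into slicewise products, so SVDs chosen independently on the
transformed slices lift to a t-SVDM. *)
Lemma is_tsvdm_approx_slices (R : rcfType) (m p n k : nat) (hm : (k <= m)%N)
    (hp : (k <= p)%N) (M : 'M[R]_n) (A B : tensor R m p n) :
  M \in unitmx ->
  is_tsvdm_approx hm hp M A B <->
  forall r, exists U S V, is_svd (mode3 A M r) U S V /\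
                          mode3 B M r = svd_trunc hm hp U S V.
Proof.
move=> uM; split=> [[U [S [V [[svdA _] ->]]]] r|slices].
  exists (mode3 U M r), (mode3 S M r), (mode3 V M r).
  by rewrite tsvdm_trunc_slice.
have [U /fin_all_exists[S /fin_all_exists[V USV]]] := fin_all_exists slices.
pose lift a b (X : 'I_n -> 'M[R]_(a, b)) : tensor R a b n :=
  mode3 [ffun r => X r] (invmx M).
have liftE a b (X : 'I_n -> 'M[R]_(a, b)) r : mode3 (lift a b X) M r = X r.
  by rewrite /lift mode3KV // ffunE.
have mode3_inj (X Y : tensor R m p n) :
    (forall r, mode3 X M r = mode3 Y M r) -> X = Y.
  move=> XY; rewrite -(mode3K X uM) -(mode3K Y uM).
  by congr mode3; apply/ffunP.
exists (lift _ _ U), (lift _ _ S), (lift _ _ V); split; last first.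
  apply: mode3_inj => r; rewrite tsvdm_trunc_slice // !liftE.
  by have [] := USV r.
split=> [r|]; first by rewrite !liftE; have [] := USV r.
apply: mode3_inj => r; rewrite !starM_slice // trM_slice // !liftE.
by have [[]] := USV r.
Qed.

Lemma first_cols_orthonormal (R : rcfType) (m k : nat) (hk : (k <= m)%N)
    (Q : 'M[R]_m) :
  orthogonal_mx Q -> (first_cols hk Q)^T *m first_cols hk Q = 1%:M.
Proof.
move=> orthQ; rewrite first_colsE trmx_mul tr_pid_mx -mulmxA orthogonal_mxK //.
by rewrite mul_pid_mx minnn (minn_idPr hk) pid_mx_1.
Qed.

Lemma frame_orthoproj (R : rcfType) (m k : nat) (G : 'M[R]_(m, k)) :
  G^T *m G = 1%:M -> is_orthoproj (G *m G^T) /\ \tr (G *m G^T) = k%:R.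
Proof.
move=> GG; split; last by rewrite mxtrace_mulC GG mxtrace1.
split; first by rewrite trmx_mul trmxK.
by rewrite mulmxA -(mulmxA G) GG mulmx1.
Qed.

(** The last factor applied in mode 1 is the one with columns in the range of
the projection, and the mode-3 products, being linear combinations of slices,
keep it there. *)
Lemma hosvd_trunc_fix1 (R : rcfType) (m p n k1 k2 k3 : nat)
    (hk1 : (k1 <= m)%N) (hk2 : (k2 <= p)%N) (hk3 : (k3 <= n)%N)
    (A : tensor R m p n) (Q : 'M[R]_m) (W : 'M[R]_p) (Z : 'M[R]_n)
    (c : nat) (F : 'M[R]_(c, n)) r :
  orthogonal_mx Q ->
  first_cols hk1 Q *m (first_cols hk1 Q)^T *m
    mode3 (hosvd_trunc hk1 hk2 hk3 A Q W Z) F r =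
  mode3 (hosvd_trunc hk1 hk2 hk3 A Q W Z) F r.
Proof.
move=> orthQ; rewrite /hosvd_trunc mode3_mode3 -mode3_mulmxl.
congr (mode3 _ _ r); apply/ffunP=> k; rewrite ffunE mode2_slice mode1_slice.
rewrite -!mulmxA [_^T *m (_ *m _)]mulmxA first_cols_orthonormal //.
by rewrite mul1mx.
Qed.

Lemma hosvd_trunc_fix2 (R : rcfType) (m p n k1 k2 k3 : nat)
    (hk1 : (k1 <= m)%N) (hk2 : (k2 <= p)%N) (hk3 : (k3 <= n)%N)
    (A : tensor R m p n) (Q : 'M[R]_m) (W : 'M[R]_p) (Z : 'M[R]_n)
    (c : nat) (F : 'M[R]_(c, n)) r :
  orthogonal_mx W ->
  mode3 (hosvd_trunc hk1 hk2 hk3 A Q W Z) F r *m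
    (first_cols hk2 W *m (first_cols hk2 W)^T) =
  mode3 (hosvd_trunc hk1 hk2 hk3 A Q W Z) F r.
Proof.
move=> orthW; rewrite /hosvd_trunc mode3_mode3 -mode3_mulmxr.
congr (mode3 _ _ r); apply/ffunP=> k; rewrite ffunE mode2_slice.
by rewrite -!mulmxA [_^T *m (_ *m _)]mulmxA first_cols_orthonormal // mul1mx.
Qed.

Lemma left_singular_orthogonal (R : rcfType) (m p : nat) (X : 'M[R]_(m, p))
    (U : 'M[R]_m) :
  left_singular_mx X U -> orthogonal_mx U.
Proof. by case=> S [V [[]]]. Qed.

(** * Comparison of the two truncations *)

Theorem theorem7p2 (R : rcfType) (m p n : nat) (A : tensor R m p n)
    (Q : 'M[R]_m) (W : 'M[R]_p) (Z : 'M[R]_n) (hQWZ : is_hosvd A Q W Z)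
    (k1 k2 k3 : nat)
    (hk1 : (k1 <= m)%N) (hk2 : (k2 <= p)%N) (hk3 : (k3 <= n)%N)
    (Akappa : tensor R m p n) :
  let Ak := hosvd_trunc hk1 hk2 hk3 A Q W Z in
  let M := Z^T in
  let kappa := minn k1 k2 in
  let hm : (kappa <= m)%N := leq_trans (geq_minl k1 k2) hk1 in
  let hp : (kappa <= p)%N := leq_trans (geq_minr k1 k2) hk2 in
  is_tsvdm_approx hm hp M A Akappa ->
  fnorm (A - Akappa) <= fnorm (A - Ak) /\
  (fnorm (A - Akappa) = fnorm (A - Ak) ->
     is_tsvdm_approx hm hp M A Ak /\
     ((forall B, is_tsvdm_approx hm hp M A B -> B = Akappa) -> Ak = Akappa)).
Proof.
move=> Ak M kappa hm hp approxA.
have [/left_singular_orthogonal orthQ /left_singular_orthogonal orthW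
      /left_singular_orthogonal orthZ] := hQWZ.
have orthM : orthogonal_mx M by exact: orthogonal_mxT.
have uM : M \in unitmx by have [] := mulmx1_unit orthM.
pose gap B r := sqnorm (mode3 A M r - mode3 B M r).
have slice r : gap Akappa r <= gap Ak r /\
    (gap Akappa r = gap Ak r ->
     exists U S V, is_svd (mode3 A M r) U S V /\
                   mode3 Ak M r = svd_trunc hm hp U S V).
  have [U [S [V [svdA]]]] :=
    (is_tsvdm_approx_slices hm hp A Akappa uM).1 approxA r.
  rewrite /gap => ->; have [k12|k21] := leqP k1 k2.
    have [projP trP] := frame_orthoproj (first_cols_orthonormal hk1 orthQ).
    apply: eckart_young_left svdA projP _ _; last exact: hosvd_trunc_fix1.
    by rewrite trP /kappa (minn_idPl k12).
  have [projP trP] := frame_orthoproj (first_cols_orthonormal hk2 orthW).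
  apply: eckart_young_right svdA projP _ _; last exact: hosvd_trunc_fix2.
  by rewrite trP /kappa (minn_idPr (ltnW k21)).
have gap_ge0 B r : 0 <= gap B r := sqnorm_ge0 _.
rewrite !(fnorm_sub_slices _ _ orthM).
split=> [|eq_norm].
  by apply/ler_wsqrtr/ler_sum => r _; have [] := slice r.
have approxAk : is_tsvdm_approx hm hp M A Ak.
  apply/(is_tsvdm_approx_slices hm hp A Ak uM) => r.
  have [_] := slice r; apply; apply/eqP; rewrite eq_sym -subr_eq0; apply/eqP.
  have sum0 : \sum_r (gap Ak r - gap Akappa r) = 0.
    rewrite sumrB; apply/eqP; rewrite subr_eq0 eq_sym.
    by rewrite -eqr_sqrt ?eq_norm ?eqxx // sumr_ge0.
  apply: (psumr_eq0P _ sum0) => // s _; rewrite subr_ge0.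
  by have [] := slice s.
by split=> // unique; exact: unique.
Qed.
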